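(* Let $R$ be an associative unital algebra over $\mathbb C$ and let $L(z)\in \mathrm{Mat}_n\otimes R\otimes\mathbb C((z))$ be a Lax matrix of $gl_n$-Gaudin type. Then the matrices $$\partial_z-L(z)\qquad\text{and}\qquad (\partial_z+L(z))^t ,$$ with entries in $R\otimes\mathbb C((z))[\partial_z]$, are Manin matrices.
   Context: A matrix $M$ with entries $M_{ij}$ in a (not necessarily commutative) associative ring is called a Manin matrix if (1) elements in the same column commute with each other, and (2) $[M_{ij},M_{kl}]=[M_{kj},M_{il}]$ for all $i,j,k,l$. An $n\times n$ matrix $L(z)$ with entries in $R((z))$ (or in $R((z^{-1}))$, or rational in $z$) is called a Lax matrix of $gl_n$-Gaudin type if $$[L_{ij}(u),L_{kl}(v)]=\frac{1}{u-v}\bigl(L_{il}(v)\delta_{jk}-L_{il}(u)\delta_{jk}-L_{kj}(v)\delta_{li}+L_{kj}(u)\delta_{li}\bigr)$$ for all $i,j,k,l$. Here $\partial_z\pm L(z)$ means $\partial_z\,\mathrm{Id}\pm L(z)$, with $\partial_z$ commuting with $R$ and $[\partial_z,f(z)]=f'(z)$; the superscript $t$ denotes transposition. *)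

(* Defs.v *)
From HB Require Import structures.
From mathcomp Require Import all_boot all_order all_algebra.
From mathcomp Require Import zify.
From mathcomp Require Import all_classical all_reals.
From mathcomp Require Import complex.

Set Implicit Arguments.
Unset Strict Implicit.
Unset Printing Implicit Defensive.

Import Order.TTheory GRing.Theory Num.Theory.
Local Open Scope ring_scope.

(* Formal Laurent series R((z)): f m is the coefficient of z^m, and only
   finitely many negative exponents occur.  The variable z is central.  For an
   algebra R over a field C this ring contains R ⊗ C((z)), as the series whose
   coefficients span a finite-dimensional subspace of R. *)

Definition laurent_pred (R : nzRingType) (f : int -> R) : bool :=
  `[< exists N : int, forall m, m < N -> f m = 0 >].

Record laurent (R : nzRingType) :=
  Laurent { lcoef :> int -> R; _ : laurent_pred lcoef }.

HB.instance Definition _ (R : nzRingType) := [isSub for @lcoef R].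
HB.instance Definition _ (R : nzRingType) := [Choice of laurent R by <:].

Section LaurentRing.
Variable R : nzRingType.
Implicit Types f g h : laurent R.

Lemma lbound f : exists N : int, forall m, m < N -> f m = 0.
Proof. by have /asboolP := valP f. Qed.

Lemma laurentP f g : (forall m, f m = g m) -> f = g.
Proof. by move=> fg; apply/val_inj/funext. Qed.

Lemma lzero_subproof : laurent_pred (fun=> 0 : R).
Proof. by apply/asboolP; exists 0. Qed.
Definition lzero := Laurent lzero_subproof.

Lemma lopp_subproof f : laurent_pred (fun m => - f m).
Proof.
by apply/asboolP; have [N fN] := lbound f; exists N => m /fN ->; rewrite oppr0.
Qed.
Definition lopp f := Laurent (lopp_subproof f).

Lemma ladd_subproof f g : laurent_pred (fun m => f m + g m).
Proof.
apply/asboolP; have [N fN] := lbound f; have [M gM] := lbound g.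
exists (Num.min N M) => m; rewrite lt_min => /andP[/fN -> /gM ->].
by rewrite addr0.
Qed.
Definition ladd f g := Laurent (ladd_subproof f g).

Lemma laddA : associative ladd.
Proof. by move=> f g h; apply/laurentP => m /=; rewrite addrA. Qed.
Lemma laddC : commutative ladd.
Proof. by move=> f g; apply/laurentP => m /=; rewrite addrC. Qed.
Lemma ladd0 : left_id lzero ladd.
Proof. by move=> f; apply/laurentP => m /=; rewrite add0r. Qed.
Lemma laddN : left_inverse lzero lopp ladd.
Proof. by move=> f; apply/laurentP => m /=; rewrite addNr. Qed.

HB.instance Definition _ :=
  GRing.isZmodule.Build (laurent R) laddA laddC ladd0 laddN.

Lemma lcoef0 m : (0 : laurent R) m = 0. Proof. by []. Qed.
Lemma lcoefN f m : (- f) m = - f m. Proof. by []. Qed.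
Lemma lcoefD f g m : (f + g) m = f m + g m. Proof. by []. Qed.
Lemma lcoefB f g m : (f - g) m = f m - g m. Proof. by []. Qed.

(* At most finitely many summands are nonzero, since both supports are bounded
   below. *)
Definition cauchy f g (m : int) : R :=
  \sum_(i \in [set: int]) f i * g (m - i).

Lemma cauchy_low f g (a b m : int) :
    (forall m, m < a -> f m = 0) -> (forall m, m < b -> g m = 0) ->
  m < a + b -> cauchy f g m = 0.
Proof.
move=> fa gb mab; apply: fsbig1 => i _; have [/fa ->|ai] := ltP i a.
  by rewrite mul0r.
by rewrite gb ?mulr0 //; lia.
Qed.

Lemma cauchyE f g (a b : int) (k : nat) :
    (forall m, m < a -> f m = 0) -> (forall m, m < b -> g m = 0) ->
  cauchy f g (a + b + k%:Z) =
  \sum_(i < k.+1) f (a + i%:Z) * g (b + (k - i)%N%:Z).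
Proof.
move=> fa gb; rewrite /cauchy.
rewrite (fsbigE [seq a + i%:Z | i <- index_iota 0 k.+1]).
- rewrite big_map big_mkord.
  apply: eq_big => [i|i _]; first by apply/asboolP.
  by congr (_ * g _); have := ltn_ord i; lia.
- by rewrite map_inj_uniq ?iota_uniq // => x y /addrI [].
- by [].
- move=> i _ ki; have [/fa ->|ai] := ltP i a; first by rewrite mul0r.
  rewrite gb ?mulr0 //; apply: contraNT ki; rewrite -leNgt => ik.
  by apply/mapP; exists `|i - a|%N; rewrite ?mem_index_iota; lia.
Qed.

Lemma lmul_subproof f g : laurent_pred (cauchy f g).
Proof.
apply/asboolP; have [a fa] := lbound f; have [b gb] := lbound g.
by exists (a + b) => m; apply: cauchy_low.
Qed.
Definition lmul f g := Laurent (lmul_subproof f g).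

Lemma lmono_subproof (c : R) (p : int) :
  laurent_pred (fun m => if m == p then c else 0).
Proof. by apply/asboolP; exists p => m; case: ltgtP. Qed.
(* c z^p *)
Definition lmono (c : R) (p : int) := Laurent (lmono_subproof c p).

Let trunc f (a : int) (k : nat) : {poly R} := \poly_(i < k.+1) f (a + i%:Z).

Let lmulE f g (a b : int) (k : nat) (p q : {poly R}) :
    (forall m, m < a -> f m = 0) -> (forall m, m < b -> g m = 0) ->
    (forall i, (i <= k)%N -> p`_i = f (a + i%:Z)) ->
    (forall i, (i <= k)%N -> q`_i = g (b + i%:Z)) ->
  lmul f g (a + b + k%:Z) = (p * q)`_k.
Proof.
move=> fa gb pf qg; rewrite [LHS](cauchyE k fa gb) coefM.
apply: eq_bigr => i _; rewrite pf ?qg //; [exact: leq_subr|exact: ltn_ord i].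
Qed.

Let truncE f a k i : (i <= k)%N -> (trunc f a k)`_i = f (a + i%:Z).
Proof. by move=> ik; rewrite coef_poly ltnS ik. Qed.

Lemma lmulA : associative lmul.
Proof.
move=> f g h; apply/laurentP => m.
have [a fa] := lbound f; have [b gb] := lbound g; have [c hc] := lbound h.
have fg0 := cauchy_low fa gb; have gh0 := cauchy_low gb hc.
have [mlt|mge] := ltP m (a + b + c).
  rewrite [LHS](@cauchy_low _ _ a (b + c)) ?addrA //.
  by rewrite [RHS](@cauchy_low _ _ (a + b) c).
have [k ->] : exists k : nat, m = a + b + c + k%:Z.
  by exists (absz (m - (a + b + c))%R); lia.
rewrite (@lmulE (lmul f g) h (a + b) c k (trunc f a k * trunc g b k)
  (trunc h c k)) //; last first.
- exact: truncE.
- move=> i ik; rewrite (@lmulE _ _ _ _ _ (trunc f a k) (trunc g b k)) //;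
  by move=> j ji; apply/truncE/(leq_trans ji).
rewrite -[a + b + c]addrA.
rewrite (@lmulE f (lmul g h) a (b + c) k (trunc f a k)
  (trunc g b k * trunc h c k)) //.
- by rewrite mulrA.
- exact: truncE.
- move=> i ik; rewrite (@lmulE _ _ _ _ _ (trunc g b k) (trunc h c k)) //;
  by move=> j ji; apply/truncE/(leq_trans ji).
Qed.

Lemma lmonoM (c : R) (p : int) f m : lmul (lmono c p) f m = c * f (m - p).
Proof.
rewrite /= /cauchy (fsbigE [:: p]) //=.
  by rewrite big_mkcond big_seq1 ifT ?eqxx //; apply/asboolP.
by move=> i _; rewrite inE => /negPf ->; rewrite mul0r.
Qed.

Lemma lMmono (c : R) (p : int) f m : lmul f (lmono c p) m = f (m - p) * c.
Proof.
rewrite /= /cauchy (fsbigE [:: m - p]) //=.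
  by rewrite big_mkcond big_seq1 ifT ?subKr ?eqxx //; apply/asboolP.
move=> i _; rewrite inE => ip; case: eqP => [e|]; last by rewrite mulr0.
by move: ip; rewrite -e subKr eqxx.
Qed.

Lemma lmul1 : left_id (lmono 1 0) lmul.
Proof. by move=> f; apply/laurentP => m; rewrite lmonoM mul1r subr0. Qed.
Lemma l1mul : right_id (lmono 1 0) lmul.
Proof. by move=> f; apply/laurentP => m; rewrite lMmono mulr1 subr0. Qed.

Lemma lmulDl : left_distributive lmul ladd.
Proof.
move=> f g h; apply/laurentP => m.
have [a fa] := lbound f; have [b gb] := lbound g; have [c hc] := lbound h.
pose d := Num.min a b.
have fd i : i < d -> f i = 0 by rewrite lt_min => /andP[/fa].
have gd i : i < d -> g i = 0 by rewrite lt_min => /andP[_ /gb].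
have fgd i : i < d -> ladd f g i = 0 by move=> id; rewrite /= fd ?gd ?addr0.
have [mlt|mge] := ltP m (d + c).
  by rewrite /= (cauchy_low fgd hc) // (cauchy_low fd hc) // (cauchy_low gd hc)
    // addr0.
have [k ->] : exists k : nat, m = d + c + k%:Z by exists (absz (m - (d + c))%R); lia.
rewrite /= (cauchyE k fgd hc) (cauchyE k fd hc) (cauchyE k gd hc) -big_split /=.
by apply: eq_bigr => i _; rewrite mulrDl.
Qed.

Lemma lmulDr : right_distributive lmul ladd.
Proof.
move=> f g h; apply/laurentP => m.
have [a fa] := lbound f; have [b gb] := lbound g; have [c hc] := lbound h.
pose d := Num.min b c.
have gd i : i < d -> g i = 0 by rewrite lt_min => /andP[/gb].
have hd i : i < d -> h i = 0 by rewrite lt_min => /andP[_ /hc].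
have ghd i : i < d -> ladd g h i = 0 by move=> id; rewrite /= gd ?hd ?addr0.
have [mlt|mge] := ltP m (a + d).
  by rewrite /= (cauchy_low fa ghd) // (cauchy_low fa gd) // (cauchy_low fa hd)
    // addr0.
have [k ->] : exists k : nat, m = a + d + k%:Z by exists (absz (m - (a + d))%R); lia.
rewrite /= (cauchyE k fa ghd) (cauchyE k fa gd) (cauchyE k fa hd) -big_split /=.
by apply: eq_bigr => i _; rewrite mulrDr.
Qed.

Lemma l1_neq0 : lmono 1 0 != lzero.
Proof.
apply/eqP => /(congr1 (fun f : laurent R => f 0)) /=.
by apply/eqP; rewrite oner_eq0.
Qed.

HB.instance Definition _ := GRing.Zmodule_isNzRing.Build (laurent R)
  lmulA lmul1 l1mul lmulDl lmulDr l1_neq0.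

Lemma lcoefM f g m : (f * g) m = \sum_(i \in [set: int]) f i * g (m - i).
Proof. by []. Qed.

Definition lX : laurent R := lmono 1 1.

Lemma lderiv_subproof f : laurent_pred (fun m => f (m + 1) *~ (m + 1)).
Proof.
apply/asboolP; have [N fN] := lbound f; exists (N - 1) => m mN.
by rewrite fN ?mul0rz //; lia.
Qed.
(* d/dz *)
Definition lderiv f := Laurent (lderiv_subproof f).

Lemma lderiv_is_zmod_morphism : zmod_morphism lderiv.
Proof. by move=> f g; apply/laurentP => m; rewrite /= mulrzBl. Qed.
HB.instance Definition _ :=
  GRing.isZmodMorphism.Build (laurent R) (laurent R) lderiv
    lderiv_is_zmod_morphism.

Lemma lderivM f g : lderiv (f * g) = lderiv f * g + f * lderiv g.
Proof.
apply/laurentP => m; rewrite lcoefD /=.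
have [a fa] := lbound f; have [b gb] := lbound g.
have f'a i : i < a - 1 -> lderiv f i = 0.
  by move=> ia; rewrite /= fa ?mul0rz //; lia.
have g'b i : i < b - 1 -> lderiv g i = 0.
  by move=> ib; rewrite /= gb ?mul0rz //; lia.
have [mlt|mge] := ltP (m + 1) (a + b).
  rewrite (cauchy_low fa gb) // (cauchy_low f'a gb) ?(cauchy_low fa g'b); try lia.
  by rewrite mul0rz addr0.
have [k mk] : exists k : nat, m + 1 = a + b + k%:Z.
  by exists (absz (m + 1 - (a + b))%R); lia.
have -> : cauchy (lderiv f) g m = cauchy (lderiv f) g (a - 1 + b + k%:Z).
  by congr cauchy; lia.
have -> : cauchy f (lderiv g) m = cauchy f (lderiv g) (a + (b - 1) + k%:Z).
  by congr cauchy; lia.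
rewrite mk (cauchyE k fa gb) (cauchyE k f'a gb) (cauchyE k fa g'b).
rewrite -big_split /= mulrz_suml; apply: eq_bigr => i _; have ik := ltn_ord i.
have -> : a - 1 + i%:Z + 1 = a + i%:Z by lia.
have -> : b - 1 + (k - i)%N%:Z + 1 = b + (k - i)%N%:Z by lia.
rewrite mulrzAl mulrzAr -mulrzDr; congr (_ *~ _); lia.
Qed.

Lemma lderivX : lderiv lX = 1.
Proof.
apply/laurentP => m /=; rewrite -subr_eq0 addrK.
by case: eqP => [->|]; rewrite ?add0r ?mulr1z ?mul0rz.
Qed.

End LaurentRing.

Arguments lX {R}.

(* Two variables: R((u))((v)) is [laurent (laurent R)], the outer variable
   being v. *)

Notation laurent2 R := (laurent (laurent R)).

Section TwoVariables.
Variable R : nzRingType.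

Definition subst_u (f : laurent R) : laurent2 R := lmono f 0.

Lemma subst_v_subproof (f : laurent R) : laurent_pred (fun m => lmono (f m) 0).
Proof.
apply/asboolP; have [N fN] := lbound f; exists N => m /fN ->.
by apply/laurentP => p /=; case: ifP.
Qed.
Definition subst_v (f : laurent R) : laurent2 R := Laurent (subst_v_subproof f).

Definition uvar : laurent2 R := subst_u lX.
Definition vvar : laurent2 R := subst_v lX.

Lemma inv_uv_subproof :
  laurent_pred (fun m : int => if 0 <= m then lmono (1 : R) (- m - 1) else 0).
Proof. by apply/asboolP; exists 0 => m; rewrite ltNge => /negPf ->. Qed.
(* 1/(u - v), the two-sided inverse of u - v: sum_(m >= 0) u^(-m-1) v^m *)
Definition inv_uv : laurent2 R := Laurent inv_uv_subproof.

Lemma vvarE : vvar = lX.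
Proof.
apply/laurentP => m; apply/laurentP => p /=.
by case: (m == 1) => //=; case: (p == 0).
Qed.

Let aux (m p : int) : inv_uv m (p - 1) - inv_uv (m - 1) p = (1 : laurent2 R) m p.
Proof.
rewrite /=; case: (ltgtP m 0) => m0.
- rewrite (_ : 0 <= m - 1 = false) ?subr0; last by lia.
  by [].
- rewrite (_ : 0 <= m - 1 = true) /=; last by lia.
  rewrite (_ : (p - 1 == - m - 1) = (p == - (m - 1) - 1)) ?subrr //.
  by apply/eqP/eqP; lia.
- rewrite m0 /= subr0 (_ : (p - 1 == - 0 - 1) = (p == 0)) //.
  by apply/eqP/eqP; lia.
Qed.

Lemma mul_inv_uv : (uvar - vvar) * inv_uv = 1.
Proof.
rewrite mulrBl vvarE; apply/laurentP => m; rewrite lcoefB !lmonoM.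
by apply/laurentP => p; rewrite lcoefB lmonoM mul1r subr0 mul1r aux.
Qed.

Lemma inv_uv_mul : inv_uv * (uvar - vvar) = 1.
Proof.
rewrite mulrBr vvarE; apply/laurentP => m; rewrite lcoefB !lMmono.
by apply/laurentP => p; rewrite lcoefB lMmono mulr1 subr0 mulr1 aux.
Qed.

End TwoVariables.

(* Differential operators R((z))[∂_z]: the polynomial p stands for
   sum_i p`_i ∂_z^i, with coefficients on the left of the powers of ∂_z. *)

Definition diffop (R : nzRingType) : Type := {poly laurent R}.

Section DiffOp.
Variable R : nzRingType.
Local Notation A := (laurent R).

HB.instance Definition _ := GRing.Zmodule.on (diffop R).

(* Left multiplication by ∂_z: ∂_z (f ∂_z^j) = f ∂_z^(j+1) + f' ∂_z^j. *)
Definition dleft (q : {poly A}) : {poly A} := q * 'X + map_poly (@lderiv R) q.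

Definition dmul (p q : diffop R) : diffop R :=
  \sum_(i < size p) p`_i *: iter i dleft q.

Definition dconst (f : A) : diffop R := f%:P.
Definition dz : diffop R := 'X.

Let dleftD : {morph dleft : p q / p + q}.
Proof. by move=> p q; rewrite /dleft mulrDl raddfD addrACA. Qed.
Let dleft0 : dleft 0 = 0.
Proof. by rewrite /dleft mul0r raddf0 addr0. Qed.
Let dleftZ (a : A) q : dleft (a *: q) = a *: dleft q + lderiv a *: q.
Proof.
apply/polyP => i; rewrite /dleft -scalerAl !(coefD, coefZ) !coef_map !coefZ /=.
by rewrite lderivM mulrDr -!addrA; congr (_ + _); rewrite addrC.
Qed.
Let iterD i : {morph iter i dleft : p q / p + q}.
Proof. by elim: i => [|i IH] p q; rewrite ?iterS ?IH ?dleftD. Qed.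
Let iter0 i : iter i dleft 0 = 0.
Proof. by elim: i => //= i ->. Qed.

Let dmulE n (p q : {poly A}) : (size p <= n)%N -> dmul p q = \sum_(i < n) p`_i *: iter i dleft q.
Proof.
move=> pn; rewrite /dmul (big_ord_widen _ (fun i => p`_i *: iter i dleft q) pn).
rewrite big_mkcond; apply: eq_bigr => i _; case: ltnP => // pi.
by rewrite nth_default // scale0r.
Qed.

Lemma dmulDl : left_distributive dmul +%R.
Proof.
move=> p q r; pose n := maxn (size p) (size q).
rewrite (@dmulE n (p + q)) ?size_polyD // (@dmulE n p) ?leq_maxl //.
rewrite (@dmulE n q) ?leq_maxr // -big_split; apply: eq_bigr => i _ /=.
by rewrite coefD scalerDl.
Qed.

Lemma dmulDr : right_distributive dmul +%R.
Proof.
move=> p q r; rewrite /dmul -big_split; apply: eq_bigr => i _ /=.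
by rewrite iterD scalerDr.
Qed.

Let dmul0 p : dmul p 0 = 0.
Proof. by rewrite /dmul big1 // => i _; rewrite iter0 scaler0. Qed.
Let d0mul p : dmul 0 p = 0.
Proof. by rewrite /dmul size_poly0 big_ord0. Qed.

Let dmulZ (a : A) p q : dmul (a *: p) q = a *: dmul p q.
Proof.
rewrite (@dmulE (size p)) ?size_scale_leq // scaler_sumr.
by apply: eq_bigr => i _; rewrite coefZ scalerA.
Qed.

Let dleft_sum n (F : 'I_n -> {poly A}) :
  dleft (\sum_i F i) = \sum_i dleft (F i).
Proof. exact: (big_morph dleft dleftD dleft0). Qed.

Let dmul_left p q : dmul (dleft p) q = dleft (dmul p q).
Proof.
rewrite dmulDl (@dmulE (size p).+1); last first.
  by apply: (leq_trans (size_polyMleq _ _)); rewrite size_polyX addn2.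
rewrite (@dmulE (size p) (map_poly _ _)) ?size_poly //.
rewrite big_ord_recl coefMX scale0r add0r -big_split dleft_sum.
apply: eq_bigr => i _; rewrite lift0 coefMX coef_map /=.
by rewrite dleftZ.
Qed.

Lemma dmulA : associative dmul.
Proof.
move=> p q r; rewrite [dmul p q]/dmul.
rewrite (big_morph (dmul ^~ r) (fun x y => dmulDl x y r) (d0mul r)) {1}/dmul.
apply: eq_bigr => i _; rewrite dmulZ; congr (_ *: _).
by elim: (nat_of_ord i) => //= j ->; rewrite dmul_left.
Qed.

Lemma dmul1 : left_id (1%:P : diffop R) dmul.
Proof. by move=> p; rewrite /dmul size_poly1 big_ord1 coefC scale1r. Qed.

Let lderiv1 : lderiv (1 : A) = 0.
Proof.
apply/laurentP => m /=; case: eqP => [->|]; by rewrite ?mulr0z ?mul0rz.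
Qed.

Let iter_dleft1 i : iter i dleft 1 = 'X^i.
Proof.
elim: i => [|i IH]; first by rewrite expr0.
rewrite iterS IH /dleft -exprSr (_ : map_poly _ _ = 0) ?addr0 //.
apply/polyP => j; rewrite coef_map coefXn coef0 /=.
by case: eqP; rewrite ?raddf0 ?lderiv1.
Qed.

Lemma d1mul : right_id (1%:P : diffop R) dmul.
Proof.
move=> p; rewrite /dmul polyC1 -[RHS]coefK poly_def.
by apply: eq_bigr => i _; rewrite iter_dleft1.
Qed.

Lemma d1_neq0 : (1%:P : diffop R) != 0.
Proof. by rewrite polyC_eq0 oner_eq0. Qed.

HB.instance Definition _ := GRing.Zmodule_isNzRing.Build (diffop R)
  dmulA dmul1 d1mul dmulDl dmulDr d1_neq0.

Lemma dconst_is_zmod_morphism : zmod_morphism dconst.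
Proof. by move=> f g; rewrite /dconst polyCB. Qed.
HB.instance Definition _ :=
  GRing.isZmodMorphism.Build A (diffop R) dconst dconst_is_zmod_morphism.

Lemma dconstM_l f (p : diffop R) : dconst f * p = f *: (p : {poly A}).
Proof.
have [->|f0] := eqVneq f 0; first by rewrite raddf0 mul0r scale0r.
by rewrite [LHS]/(dmul _ _) /dmul size_polyC f0 big_ord1 coefC.
Qed.

Lemma dconst_is_monoid_morphism : monoid_morphism dconst.
Proof.
by split=> // f g; rewrite dconstM_l /dconst polyCM mul_polyC.
Qed.
HB.instance Definition _ :=
  GRing.isMonoidMorphism.Build A (diffop R) dconst dconst_is_monoid_morphism.

Lemma dz_mul (p : diffop R) : dz * p = dleft p.
Proof.
rewrite [LHS]/(dmul _ _) /dmul size_polyX !big_ord_recl big_ord0.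
by rewrite !coefX scale0r scale1r add0r addr0.
Qed.

Lemma dz_comm f : dz * dconst f - dconst f * dz = dconst (lderiv f).
Proof.
rewrite dz_mul dconstM_l /dleft /dconst /dz mul_polyC map_polyC.
by rewrite addrC; exact: (@addKr {poly A}).
Qed.

End DiffOp.

Arguments dz {R}.
Arguments dconst {R}.

Definition comm (A : pzRingType) (a b : A) : A := a * b - b * a.

Definition manin (A : pzRingType) (m n : nat) (M : 'M[A]_(m, n)) : Prop :=
  (forall j i k, comm (M i j) (M k j) = 0) /\
  (forall i j k l, comm (M i j) (M k l) = comm (M k j) (M i l)).

(* The quotient by u - v is taken in R((u))((v)); there u - v is invertible and
   the numerator is divisible by it in R[[u, v]][u^-1, v^-1], so expanding
   1/(u - v) in the region |v| < |u| rather than |u| < |v| is immaterial. *)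
Definition gaudin_lax (R : nzRingType) (n : nat) (L : 'M[laurent R]_n) : Prop :=
  forall i j k l : 'I_n,
    comm (subst_u (L i j)) (subst_v (L k l)) =
    inv_uv R * (subst_v (L i l) * (j == k)%:R - subst_u (L i l) * (j == k)%:R
                - subst_v (L k j) * (l == i)%:R + subst_u (L k j) * (l == i)%:R).

(* Main.v *)
(* Applying d/du to the Gaudin relation multiplied by u - v, and then setting
   u = v = z, gives
   [L_ij(z), L_kl(z)] = delta_li L_kj'(z) - delta_jk L_il'(z).
   Together with [d/dz, f] = f' this makes all commutators of entries of
   d/dz - L and d/dz + L explicit, and the Manin relations can be read off. *)
Require Import Defs.
From mathcomp Require Import all_boot all_order all_algebra.
From mathcomp Require Import zify.
From mathcomp Require Import all_classical all_reals.
From mathcomp Require Import complex.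
Import Order.TTheory GRing.Theory Num.Theory.
Local Open Scope ring_scope.

Section Laurent.
Variable R : nzRingType.
Implicit Types f g h : laurent R.

Lemma lcoefM_seq f g (m : int) (r : seq int) :
    uniq r -> (forall i, i \notin r -> f i * g (m - i) = 0) ->
  (f * g) m = \sum_(i <- r) f i * g (m - i).
Proof.
move=> ur r0; rewrite lcoefM (fsbigE r) //; last by move=> i _; apply: r0.
by apply: eq_bigl => i; apply/asboolP.
Qed.

(* The hypothesis says (u - v) [f(u), g(v)] = h(v) - h(u), p and m being the
   exponents of u and v. Applying d/du at u = v amounts to multiplying by p and
   summing over p + m = s + 1; the left side is then summed by parts. *)
Lemma comm_diagonal f g h :
    (forall p m : int, comm (f (p - 1)) (g m) - comm (f p) (g (m - 1)) =
       (if p == 0 then h m else 0) - (if m == 0 then h p else 0)) ->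
  comm f g = - lderiv h.
Proof.
move=> fgh; apply/laurentP => s.
have [a fa] := Defs.lbound f; have [b gb] := Defs.lbound g.
(* The window [-N <= p < N] contains [s + 1] and every [p] with [f p] and [g (s - p)] both nonzero.
   The extra 2 makes [g (s - p)] vanish already at [p = N - 1], the upper boundary term of the
   telescoping below. *)
pose N := (`|a| + `|b| + `|s| + 2)%N.
pose q (i : nat) : int := i%:Z - N%:Z.
pose r := [seq q i | i <- index_iota 0 (N + N)].
have q_inj : injective q by move=> x y; rewrite /q; lia.
have ur : uniq r by rewrite map_inj_uniq ?iota_uniq.
have rN p : p \notin r -> p < - N%:Z \/ N%:Z <= p.
  move=> pr; have [|pN] := ltP p (- N%:Z); first by left.
  have [|Np] := leP N%:Z p; first by right.
  case/negP: pr; apply/mapP; exists (absz (p + N%:Z)%R);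
    rewrite ?mem_index_iota /q; lia.
have low p : p < - N%:Z -> f p = 0 by move=> pN; apply: fa; lia.
have high p : N%:Z - 1 <= p -> g (s - p) = 0 by move=> pN; apply: gb; lia.
pose D (p : int) := comm (f p) (g (s - p)).
have -> : comm f g s = \sum_(i <- r) D i.
  rewrite /comm lcoefB (@lcoefM_seq f g s r) //; last first.
    move=> p /rN[/low ->|Np]; first by rewrite mul0r.
    by rewrite high ?mulr0 //; lia.
  (* Reflecting the index by [p -> s - p] pairs the terms of [g * f] with those of [f * g]. *)
  rewrite (@lcoefM_seq g f s [seq s - p | p <- r]); first last.
  - move=> p pr; have /rN[/low ->|Np] : s - p \notin r.
    + by apply: contra pr => pr; apply/mapP; exists (s - p); rewrite ?subKr.
    + by rewrite mulr0.
    by rewrite -[p](subKr s) high ?mul0r //; lia.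
  - by rewrite map_inj_uniq // => x y /addrI /oppr_inj.
  rewrite [X in _ - X]big_map -sumrB; apply: eq_bigr => p _.
  by rewrite subKr.
have D0 p : p < - N%:Z \/ N%:Z - 1 <= p -> D p = 0.
  by rewrite /D /comm => -[/low ->|/high ->]; rewrite ?mul0r ?mulr0 subrr.
(* This is the hypothesis on the antidiagonal [m = s + 1 - p], where [m = 0] means [p = s + 1]. *)
have DE p : D (p - 1) - D p =
    (if p == 0 then h (s + 1) else 0) - (if p == s + 1 then h (s + 1) else 0).
  have := fgh p (s + 1 - p); rewrite /D.
  rewrite (_ : s + 1 - p - 1 = s - p); last by lia.
  rewrite (_ : s - (p - 1) = s + 1 - p); last by lia.
  move=> ->; congr (_ - _); first by case: eqP => // ->; rewrite subr0.
  by rewrite subr_eq0 eq_sym; case: eqP => // ->.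
(* The two sums differ by the telescoping sum of [(p + 1) D(p) - p D(p - 1)], whose end terms vanish
   by [D0]. *)
have -> : \sum_(p <- r) D p = \sum_(p <- r) (D (p - 1) - D p) *~ p.
  apply/eqP; rewrite -subr_eq0 -sumrB big_map.
  rewrite (eq_bigr (fun i => D (q i.+1 - 1) *~ q i.+1 - D (q i - 1) *~ q i)).
    rewrite telescope_sumr // !D0 ?mul0rz ?subrr // /q; lia.
  move=> i _; rewrite (_ : q i.+1 - 1 = q i); last by rewrite /q; lia.
  rewrite (_ : q i.+1 = 1 + q i); last by rewrite /q; lia.
  rewrite [X in _ = X - _]mulrzDr mulr1z mulrzBl.
  by rewrite opprB addrA.
have sr p : - N%:Z <= p < N%:Z -> p \in r.
  move=> pN; apply/mapP; exists (absz (p + N%:Z)%R);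
    rewrite ?mem_index_iota /q; lia.
rewrite lcoefN /=.
(* The weight [p] kills the term at [p = 0]; the one at [p = s + 1] leaves [-(s + 1) h(s + 1)], the
   coefficient of [z^s] in [-h']. *)
under eq_bigr do rewrite DE mulrzBl.
rewrite sumrB big1 => [|p _]; last first.
  by case: eqP => [->|]; rewrite ?mulr0z ?mul0rz.
rewrite sub0r (bigD1_seq (s + 1)) //=; last by apply: sr; lia.
rewrite eqxx big1 ?addr0 // => p /negPf ->.
by rewrite mul0rz.
Qed.

(** The outer index [m] is the exponent of v, the inner index [p] that of u; each coefficient of the
    product is a single term. *)
Lemma comm_subst f g (p m : int) :
  comm (subst_u f) (subst_v g) m p = comm (f p) (g m).
Proof. by rewrite /comm lcoefB lmonoM 2!lMmono lmonoM !subr0. Qed.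

Lemma lcoef_uv (F : laurent2 R) (p m : int) :
  ((uvar R - vvar R) * F) m p = F m (p - 1) - F (m - 1) p.
Proof. by rewrite mulrBl vvarE lcoefB !lmonoM !mul1r !subr0. Qed.

Lemma gaudin_lax_comm (n : nat) (L : 'M[laurent R]_n) (hL : gaudin_lax L)
    (i j k l : 'I_n) :
  comm (L i j) (L k l) =
  lderiv (L k j) *+ (l == i) - lderiv (L i l) *+ (j == k).
Proof.
(* Here [h] is [L i l *+ (j == k) - L k j *+ (l == i)]. *)
rewrite -!raddfMn -opprB -raddfB; apply: comm_diagonal => p m.
rewrite -2!comm_subst -lcoef_uv hL mulrA mul_inv_uv mul1r.
have sv (b : bool) f : subst_v f * b%:R = subst_v (f *+ b).
  rewrite mulr_natr; case: b; rewrite ?mulr1n ?mulr0n //; apply/laurentP => x.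
  by apply/laurentP => y /=; case: ifP.
have su (b : bool) f : subst_u f * b%:R = subst_u (f *+ b).
  rewrite mulr_natr; case: b; rewrite ?mulr1n ?mulr0n //; apply/laurentP => x.
  by apply/laurentP => y /=; case: ifP.
rewrite !sv !su; set v := L i l *+ _; set w := L k j *+ _.
rewrite !(lcoefD, lcoefN) /=.
have -> (a b c d : R) : a - b - c + d = a - c - (b - d).
  by rewrite opprD opprK addrACA addrA.
by case: (m == 0); case: (p == 0); rewrite /= ?subr0.
Qed.

End Laurent.

Section Comm.
Variable A : pzRingType.
Implicit Types a b c : A.

Lemma commC a b : comm a b = - comm b a.
Proof. by rewrite /comm opprB. Qed.

Lemma commDl a b c : comm (a + b) c = comm a c + comm b c.
Proof. by rewrite /comm mulrDl mulrDr opprD addrACA. Qed.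

Lemma commDr a b c : comm a (b + c) = comm a b + comm a c.
Proof. by rewrite commC commDl opprD -!(commC a). Qed.

Lemma comm_mulrnl a b (k : nat) : comm (a *+ k) b = comm a b *+ k.
Proof. by rewrite /comm mulrnAl mulrnAr mulrnBl. Qed.

Lemma comm_mulrnr a b (k : nat) : comm a (b *+ k) = comm a b *+ k.
Proof. by rewrite commC comm_mulrnl -mulNrn -commC. Qed.

End Comm.

Section DiffOp.
Variable R : nzRingType.

(** The multiples [a] and [b] stand for Kronecker deltas, so diagonal and off-diagonal entries are
    treated at once. *)
Lemma comm_dz_dconst (f g : laurent R) (a b : nat) :
  comm (dz *+ a + dconst f) (dz *+ b + dconst g) =
  dconst (lderiv g *+ a - lderiv f *+ b + comm f g).
Proof.
have dza (c : laurent R) : comm dz (dconst c) = dconst (lderiv c) := dz_comm c.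
rewrite commDl !commDr !(comm_mulrnl, comm_mulrnr) dza.
rewrite (commC _ (dconst f)) dza /comm subrr !mul0rn add0r.
by rewrite raddfD !raddfB !raddfMn /= !rmorphM mulNrn addrA.
Qed.

End DiffOp.

Theorem proposition2 (K : realType) (R : algType K[i]) (n : nat)
    (L : 'M[laurent R]_n) (hL : gaudin_lax L) :
  manin (dz%:M - map_mx dconst L) /\ manin ((dz%:M + map_mx dconst L)^T).
Proof.
(* Replacing [L] by [-L] flips the terms coming from [dz] but not the bracket of two entries of
   [L]. *)
have minus i j k l :
  comm ((dz%:M - map_mx dconst L) i j) ((dz%:M - map_mx dconst L) k l) =
  dconst (lderiv (L i j) *+ (k == l) - lderiv (L k l) *+ (i == j)
          + (lderiv (L k j) *+ (l == i) - lderiv (L i l) *+ (j == k))).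
  rewrite !mxE -!raddfN comm_dz_dconst !raddfN /= -gaudin_lax_comm //.
  by rewrite /comm !mulNr !mulrN !opprK !mulNrn opprK [- _ + _]addrC.
have plus i j k l :
  comm ((dz%:M + map_mx dconst L)^T i j) ((dz%:M + map_mx dconst L)^T k l) =
  dconst (lderiv (L l k) *+ (j == i) - lderiv (L j i) *+ (l == k)
          + (lderiv (L l i) *+ (k == j) - lderiv (L j k) *+ (i == l))).
  by rewrite !mxE comm_dz_dconst -gaudin_lax_comm.
(* In both formulas, exchanging [i] and [k] swaps the first pair of terms with the second, and for
   [j = l] the two pairs cancel. *)
split; split=> [j i k|i j k l]; rewrite ?minus ?plus.
- by rewrite (eq_sym k j) (eq_sym j i) -[X in _ + X]opprB subrr raddf0.
- by rewrite addrC (eq_sym l i) (eq_sym j k) (eq_sym k l) (eq_sym i j).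
- by rewrite (eq_sym k j) (eq_sym i j) -[X in _ + X]opprB subrr raddf0.
- by rewrite addrC (eq_sym k j) (eq_sym i l) (eq_sym j i) (eq_sym l k).
Qed.
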